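(* For every integer $n\geq 2$, $$p_n \leq \mathbb{P}\left(1,3,9,\dots,3^{n-1}\right) = \frac{1}{3^{n-1}}.$$
   Context: Here $\mathbb{N}$ denotes the positive integers. For $a_1,\dots,a_n\in\mathbb{N}$ define $$\mathbb{P}(a_1,\dots,a_n)=\frac{1}{2\pi}\left|\left\{x\in[0,2\pi]:\ \min_{1\le i\le n}\cos(a_i x)>0\ \text{ or }\ \max_{1\le i\le n}\cos(a_i x)<0\right\}\right|,$$ where $|\cdot|$ denotes Lebesgue measure. Define $$p_n=\inf \mathbb{P}(a_1,\dots,a_n),$$ where the infimum is over all sets $\{a_1,\dots,a_n\}\subset\mathbb{N}$ with $a_1<a_2<\dots<a_n$. *)

(* Defs.v *)
From HB Require Import structures.
From mathcomp Require Import all_boot all_order all_algebra.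
From mathcomp Require Import all_classical all_reals all_analysis.

Set Implicit Arguments.
Unset Strict Implicit.
Unset Printing Implicit Defensive.

Import Order.TTheory GRing.Theory Num.Theory.

Local Open Scope classical_set_scope.
Local Open Scope ring_scope.

(* For n > 0 the default values 1 and -1 of the iterated min and max do not   *)
(* affect the result, since -1 <= cos <= 1.                                   *)
Definition same_sign_set (R : realType) (n : nat) (a : 'I_n -> nat) : set R :=
  [set x | x \in `[0, 2 * pi] /\
    (0 < \big[Num.min/1]_(i < n) cos ((a i)%:R * x) \/
     \big[Num.max/-1]_(i < n) cos ((a i)%:R * x) < 0)].

Definition same_sign_prob (R : realType) (n : nat) (a : 'I_n -> nat) : \bar R :=
  ((2 * pi)^-1%:E * lebesgue_measure (@same_sign_set R n a))%E.

(* A set of n positive integers is given by its increasing enumeration.       *)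
Definition admissible (n : nat) (a : 'I_n -> nat) : Prop :=
  (forall i, (0 < a i)%N) /\ (forall i j : 'I_n, (i < j)%N -> (a i < a j)%N).

Definition min_same_sign_prob (R : realType) (n : nat) : \bar R :=
  ereal_inf [set same_sign_prob R a | a in [set a : 'I_n -> nat | admissible a]].

(* Main.v *)
(* Near 0, cos (3 ^ i * t) > 0 for all i <= m exactly when
   |t| < pi / (2 * 3 ^ m): each test puts the next argument in the range
   |u| < 3 pi / 2, where cos u > 0 means |u| < pi / 2. Since all 3 ^ i are odd,
   translation by pi turns the negative case into the positive one, so the
   same-sign set in [0, 2 pi] consists of the points at distance less than
   pi / (2 * 3 ^ m) from 0, pi or 2 pi. *)
Require Import Defs.
From HB Require Import structures.
From mathcomp Require Import all_boot all_order all_algebra.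
From mathcomp Require Import all_classical all_reals all_analysis.
From mathcomp Require Import lra ring.

Import Order.TTheory GRing.Theory Num.Theory.

Local Open Scope classical_set_scope.
Local Open Scope ring_scope.

Section cos_powers_of_three.
Variable R : realType.
Implicit Types (t x : R) (m n : nat).

Let pi_pos : 0 < pi :> R := pi_gt0 R.

Lemma cos_gt0_3pihalf t : `|t| <= 3 * pi / 2 -> (0 < cos t) = (`|t| < pi / 2).
Proof.
have pi0 := pi_pos.
rewrite -[cos t]cos_norm; have := normr_ge0 t; move: (`|t| : R) => u u0 u3.
have [ult|uge] := ltP u (pi / 2).
  by rewrite cos_gt0_pihalf//; apply/andP; split; lra.
(* For [pi / 2 <= u <= 3 * pi / 2], moving back by [pi] lands where cosine is nonnegative, and the
   move flips the sign. *)
have /cos_ge0_pihalf : - (pi / 2) <= u - pi <= pi / 2.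
  by apply/andP; split; lra.
have -> : cos u = - cos (u - pi) by rewrite -cosDpi subrK.
by rewrite oppr_gt0 => ?; apply/negbTE; rewrite -leNgt.
Qed.

Lemma cos_pow3_gt0 m t : `|t| <= 3 * pi / 2 ->
  (forall i, (i <= m)%N -> 0 < cos ((3 ^ i)%:R * t)) <->
  `|t| < pi / (2 * 3 ^+ m).
Proof.
have pi0 := pi_pos => t3.
elim: m => [|m IHm].
  rewrite expr0 mulr1 -cos_gt0_3pihalf //; split=> [/(_ 0%N isT)|ct i].
    by rewrite expn0 mul1r.
  by rewrite leqn0 => /eqP ->; rewrite expn0 mul1r.
have p0 : 0 < 3 ^+ m :> R by rewrite exprn_gt0.
(* The bound reached after test [m] gives [3 ^+ m.+1 * |t| < 3 * pi / 2], exactly the range in which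
   [cos_gt0_3pihalf] decides the next sign. *)
have last_test : `|t| < pi / (2 * 3 ^+ m) ->
    (0 < cos ((3 ^ m.+1)%:R * t)) = (`|t| < pi / (2 * 3 ^+ m.+1)).
  rewrite !ltr_pdivlMr ?mulr_gt0 ?exprn_gt0// exprS => tm.
  rewrite cos_gt0_3pihalf natrX exprS normrM ger0_norm ?mulr_ge0 ?ltW//.
    by apply/idP/idP; nra.
  by nra.
split=> [pos|tm].
  rewrite -last_test; first exact: pos.
  by apply/IHm => i im; apply: pos; exact: leqW.
have tm' : `|t| < pi / (2 * 3 ^+ m).
  move: tm; rewrite !ltr_pdivlMr ?mulr_gt0 ?exprn_gt0// exprS.
  by have := normr_ge0 t; nra.
move=> i; rewrite leq_eqVlt => /predU1P[->|]; first by rewrite last_test.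
exact: (IHm.2 tm').
Qed.

Lemma cosDnpi_odd k t : odd k -> cos (t + k%:R * pi) = - cos t.
Proof.
by move=> ok; rewrite mulr_natl (alternatingn (@cosDpi R)) -signr_odd ok mulN1r.
Qed.

Lemma cos_natrMB2pi k t : cos (k%:R * (t - 2 * pi)) = cos (k%:R * t).
Proof.
rewrite -(periodicn (@cosD2pi R) k (k%:R * (t - 2 * pi))).
by congr cos; rewrite -[_ *+ k]mulr_natl -[pi *+ 2]mulr_natl; ring.
Qed.

Let radius m : R := pi / (2 * 3 ^+ m).

(** The upper bound keeps the neighbourhoods of 0, [pi] and [2 * pi] disjoint; equality occurs at
    [m = 0]. *)
Let radius_bounds m : 0 < radius m <= pi / 2.
Proof.
have p1 : 1 <= 3 ^+ m :> R by rewrite exprn_ege1 // ler1n.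
apply/andP; split.
  by rewrite divr_gt0 ?pi_pos// mulr_gt0// exprn_gt0.
rewrite ler_pM2l ?pi_pos// lef_pV2 ?posrE ?mulr_gt0 ?exprn_gt0//.
by lra.
Qed.

Lemma cos_pow3_gt0_itv m x : 0 <= x <= 2 * pi ->
  (forall i, (i <= m)%N -> 0 < cos ((3 ^ i)%:R * x)) <->
  (x < radius m \/ 2 * pi - radius m < x).
Proof.
have pi0 := pi_pos; have /andP[r0 r2] := radius_bounds m.
(* Up to [3 * pi / 2] the criterion around 0 applies to [x] itself; beyond, it applies to
   [x - 2 * pi], which lies in []- pi / 2, 0]]. Since [radius m <= pi / 2], each case excludes the
   other alternative. *)
move=> /andP[x0 x2]; have [x3|x3] := lerP x (3 * pi / 2).
  rewrite cos_pow3_gt0 ?ger0_norm// -/(radius m).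
  by split=> [?|[//|?]]; [left|lra].
have {1}-> : (forall i, (i <= m)%N -> 0 < cos ((3 ^ i)%:R * x)) <->
    (forall i, (i <= m)%N -> 0 < cos ((3 ^ i)%:R * (x - 2 * pi))).
  by split=> H i /H; rewrite cos_natrMB2pi.
have nx : `|x - 2 * pi| = 2 * pi - x by rewrite ler0_norm; lra.
rewrite cos_pow3_gt0 nx -/(radius m); last by lra.
by split=> [?|[?|?]]; [right| |]; lra.
Qed.

Lemma cos_pow3_lt0_itv m x : 0 <= x <= 2 * pi ->
  (forall i, (i <= m)%N -> cos ((3 ^ i)%:R * x) < 0) <->
  pi - radius m < x < pi + radius m.
Proof.
have pi0 := pi_pos; move=> /andP[x0 x2].
(* The arguments differ by [3 ^ i] times [pi], an odd multiple. *)
have shift i : cos ((3 ^ i)%:R * x) = - cos ((3 ^ i)%:R * (x - pi)).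
  by rewrite -(@cosDnpi_odd (3 ^ i)) ?oddX ?orbT// -mulrDr subrK.
have -> : (forall i, (i <= m)%N -> cos ((3 ^ i)%:R * x) < 0) <->
    (forall i, (i <= m)%N -> 0 < cos ((3 ^ i)%:R * (x - pi))).
  by split=> H i /H; rewrite shift oppr_lt0.
rewrite cos_pow3_gt0 -/(radius m); last by rewrite ler_norml; lra.
by rewrite ltr_norml; split; lra.
Qed.

Lemma same_sign_set_pow3 m :
  same_sign_set (fun i : 'I_m.+1 => (3 ^ i)%N) =
  `[0, radius m[ `|` `]pi - radius m, pi + radius m[
    `|` `]2 * pi - radius m, 2 * pi] :> set R.
Proof.
have pi0 := pi_pos; have /andP[r0 r2] := radius_bounds m.
(* The default value 1 only adds the true condition [0 < 1]; likewise -1 for the maximum below. *)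
have gt0E x : 0 < \big[Num.min/1]_(i < m.+1) cos ((3 ^ i)%:R * x) <->
    (forall i, (i <= m)%N -> 0 < cos ((3 ^ i)%:R * x)).
  split=> [/bigmin_gtP[_ H] i im|H].
    exact: (H (Ordinal (im : (i < m.+1)%N))).
  by apply/bigmin_gtP; split=> [//|i _]; apply: H; rewrite -ltnS.
have lt0E x : \big[Num.max/-1]_(i < m.+1) cos ((3 ^ i)%:R * x) < 0 <->
    (forall i, (i <= m)%N -> cos ((3 ^ i)%:R * x) < 0).
  split=> [/bigmax_ltP[_ H] i im|H].
    exact: (H (Ordinal (im : (i < m.+1)%N))).
  by apply/bigmax_ltP; split=> [|i _]; [rewrite oppr_lt0|apply: H; rewrite -ltnS].
rewrite /same_sign_set; apply/seteqP; split=> x /=.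
  rewrite gt0E lt0E !in_itv/= => -[/[dup] /andP[x0 x2] x02].
  rewrite cos_pow3_gt0_itv// cos_pow3_lt0_itv//.
  by case=> [[?|?]|?]; [left; left|right|left; right] => //; apply/andP.
rewrite gt0E lt0E !in_itv/= => H.
have x02 : 0 <= x <= 2 * pi by case: H => [[|]|]; lra.
split=> //; rewrite cos_pow3_gt0_itv// cos_pow3_lt0_itv//.
by case: H => [[/andP[]|]|/andP[]]; tauto.
Qed.

Lemma same_sign_prob_pow3 m :
  same_sign_prob R (fun i : 'I_m.+1 => (3 ^ i)%N) = (1 / 3 ^+ m)%:E.
Proof.
have pi0 := pi_pos; have /andP[r0 r2] := radius_bounds m.
set A : set R := `[0, radius m[%classic.
set B : set R := `]pi - radius m, pi + radius m[%classic.
set C : set R := `]2 * pi - radius m, 2 * pi]%classic.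
have muU : (lebesgue_measure (A `|` B `|` C) =
    lebesgue_measure A + lebesgue_measure B + lebesgue_measure C)%E.
  have mA : measurable A by exact: measurable_itv.
  have mB : measurable B by exact: measurable_itv.
  have mC : measurable C by exact: measurable_itv.
  have AB : A `&` B = set0.
    by apply/seteqP; split=> x //; rewrite /A /B /= !in_itv/=; lra.
  have ABC : (A `|` B) `&` C = set0.
    by apply/seteqP; split=> x //; rewrite /A /B /C /= !in_itv/=; lra.
  by rewrite !measureU//; exact: measurableU.
rewrite /same_sign_prob same_sign_set_pow3 muU /A /B /C.
(* All three intervals are nonempty, with lengths [radius m], [2 * radius m] and [radius m]; the
   total [4 * radius m] over [2 * pi] is [1 / 3 ^+ m]. *)
rewrite !lebesgue_measure_itv/= !lte_fin !ifT; [|lra..].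
rewrite -!EFinD -EFinM; congr EFin; rewrite /radius.
have p3 : 3 ^+ m != 0 :> R by rewrite expf_neq0.
have pi_neq0 : pi != 0 :> R by rewrite gt_eqF.
(* Only the nonvanishing of [3 ^+ m] and [pi] matters now, so both become variables for [field]. *)
move: (3 ^+ m) (pi : R) p3 pi_neq0 => q p q0 p0.
by field; rewrite q0 p0.
Qed.

End cos_powers_of_three.

Lemma admissible_pow3 n : admissible (fun i : 'I_n => (3 ^ i)%N).
Proof. by split=> [i|i j]; rewrite ?expn_gt0// ltn_exp2l. Qed.

Theorem mainTheorem2 (R : realType) (n : nat) (hn : (2 <= n)%N) :
  (min_same_sign_prob R n <= same_sign_prob R (fun i : 'I_n => (3 ^ i)%N))%E /\
  same_sign_prob R (fun i : 'I_n => (3 ^ i)%N) = (1 / 3 ^+ n.-1)%:E.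
Proof.
split.
  apply: ereal_inf_lbound; exists (fun i : 'I_n => (3 ^ i)%N) => //.
  exact: admissible_pow3.
by case: n hn => // m _; exact: same_sign_prob_pow3.
Qed.
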